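(* Let $\Gamma$ be a countably infinite discrete group and let $\boldsymbol{a} = \Gamma \curvearrowright^a (X,\mu)$ be a non-trivial measure preserving action of $\Gamma$. Suppose that $\boldsymbol{a}$ is totally ergodic. Then there exists a finite normal subgroup $N$ of $\Gamma$ such that the stabilizer $\Gamma_x$ of $\mu$-almost every $x\in X$ is equal to $N$.
   Context: A measure preserving action $\boldsymbol{a}=\Gamma\curvearrowright^a (X,\mu)$ consists of a standard Borel space $X$, a Borel probability measure $\mu$ on $X$, and a Borel action $a:\Gamma\times X\to X$ preserving $\mu$; write $\gamma^a x$ for $a(\gamma,x)$. The action is non-trivial if $\mu$ is not a point mass. It is totally ergodic if the restriction of the action to every infinite subgroup of $\Gamma$ is ergodic. The stabilizer of $x$ is $\Gamma_x=\{\gamma\in\Gamma : \gamma^a x = x\}$. *)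

(* Defs.v *)
From HB Require Import structures.
From mathcomp Require Import all_boot all_order all_algebra.
From mathcomp Require Import all_classical all_reals all_analysis.
Set Implicit Arguments. Unset Strict Implicit. Unset Printing Implicit Defensive.
Import Order.TTheory GRing.Theory Num.Theory.
Local Open Scope classical_set_scope.
Local Open Scope ring_scope.

Definition is_group (G : Type) (mul : G -> G -> G) (one : G) (inv : G -> G) : Prop :=
  [/\ (forall x y z, mul x (mul y z) = mul (mul x y) z),
      (forall x, mul one x = x), (forall x, mul x one = x),
      (forall x, mul (inv x) x = one) & (forall x, mul x (inv x) = one)].

Definition countably_infinite (G : Type) : Prop :=
  exists f : nat -> G, bijective f.

Definition is_subgroup (G : Type) (mul : G -> G -> G) (one : G) (inv : G -> G)
  (H : set G) : Prop :=
  [/\ H one, (forall x y, H x -> H y -> H (mul x y)) & (forall x, H x -> H (inv x))].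

Definition is_normal (G : Type) (mul : G -> G -> G) (inv : G -> G) (H : set G) : Prop :=
  forall g n, H n -> H (mul (mul g n) (inv g)).

(* Standard Borel space: Borel isomorphic to a Borel subset of the real line
   (Kuratowski's characterization of standard Borel spaces). *)
Definition standard_borel (R : realType) (d : measure_display) (X : measurableType d) : Prop :=
  exists (f : X -> R), [/\ injective f, measurable_fun setT f,
    measurable (range f) &
    (forall A : set X, measurable A -> measurable (f @` A))].

(* a : G -> X -> X is a Borel action (G discrete countable, so Borel means each
   a g is measurable) preserving mu. *)
Definition is_mp_action (G : Type) (mul : G -> G -> G) (one : G)
  (R : realType) (d : measure_display) (X : measurableType d)
  (mu : probability X R) (a : G -> X -> X) : Prop :=
  [/\ (forall x, a one x = x),
      (forall g h x, a (mul g h) x = a g (a h x)),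
      (forall g, measurable_fun setT (a g)) &
      (forall g (A : set X), measurable A -> mu (a g @^-1` A) = mu A)].

Definition nontrivial_measure (R : realType) (d : measure_display) (X : measurableType d)
  (mu : probability X R) : Prop :=
  ~ (exists x0 : X, forall A : set X, measurable A -> mu A = \d_x0 A).

Definition ergodic_on (G : Type) (R : realType) (d : measure_display) (X : measurableType d)
  (mu : probability X R) (a : G -> X -> X) (H : set G) : Prop :=
  forall A : set X, measurable A -> (forall h, H h -> a h @^-1` A = A) ->
    mu A = 0%E \/ mu A = 1%E.

Definition totally_ergodic (G : Type) (mul : G -> G -> G) (one : G) (inv : G -> G)
  (R : realType) (d : measure_display) (X : measurableType d)
  (mu : probability X R) (a : G -> X -> X) : Prop :=
  forall H : set G, is_subgroup mul one inv H -> infinite_set H -> ergodic_on mu a H.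

Definition stabilizer (G X : Type) (a : G -> X -> X) (x : X) : set G :=
  [set g | a g x = x].

(* Main.v *)
(** Almost every stabilizer is finite.  Otherwise some [H = stabilizer x0] is
    infinite, where [x0] avoids the countably many null sets [fixed g] and
    [fixed_all L], [L] ranging over the infinite finitely generated subgroups.
    Then [H] is locally finite and each [fixed g], [g] in [H], has positive
    measure; pick [gam] in [H] for which it is not conull.  Its centralizer
    leaves [fixed gam] invariant, so total ergodicity makes it finite, of order
    [c] say.  Averaging over finite subgroups of [H] then shows that every set of
    positive measure has measure at least [mu (fixed gam) / c].  Hence [mu] has an
    atom; its stabilizer in [H] is infinite, hence ergodic, so [mu] is a point
    mass.  This replaces the theorem of Hall-Kulatilaka and Kargapolov on infinite
    abelian subgroups of locally finite groups.

    There are countably many finite subgroups, so some set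
    [{x | stabilizer x = N}] has positive measure.  Its translates coincide or are
    disjoint, so the subgroup preserving it has finite index; it is therefore
    infinite, and ergodicity makes the set conull. *)

Require Import Defs.
From HB Require Import structures.
From mathcomp Require Import finmap.
From mathcomp Require Import all_boot all_order all_algebra.
From mathcomp Require Import all_classical all_reals all_analysis.
From mathcomp Require Import measurable_realfun.
Import Order.TTheory GRing.Theory Num.Theory.
Local Open Scope classical_set_scope.
Local Open Scope ring_scope.

(** * Counting in finite lists *)

(** Right translation by the inverse of one fixed [h] in [P] maps the counted elements injectively
    into [t]. *)
Lemma count_le_translates (G : eqType) (mul : G -> G -> G) (one : G)
    (inv : G -> G) (s t : seq G) (P : pred G) :
  is_group mul one inv -> uniq s ->
  (forall g h, P g -> P h -> mul g (inv h) \in t) ->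
  (count P s <= size t)%N.
Proof.
move=> [mA m1 mg1 mV mgV] us Pt; rewrite -size_filter.
case E : [seq g <- s | P g] => [//|h r]; rewrite -E.
have Ph : P h by have := mem_head h r; rewrite -E mem_filter => /andP[].
rewrite -(size_map (fun g => mul g (inv h))); apply: uniq_leq_size.
  rewrite map_inj_uniq ?filter_uniq// => g g' /(congr1 (mul^~ h)).
  by rewrite /= -!mA mV !mg1.
by move=> _ /mapP[g + ->]; rewrite mem_filter => /andP[Pg _]; exact: Pt.
Qed.

Lemma count_le_fibers (T : eqType) (s : seq T) (P Q : pred T) (phi : T -> T)
    (c : nat) :
  uniq s -> {in s, forall h, P h -> (phi h \in s) && Q (phi h)} ->
  (forall k, (count (fun h => phi h == k) s <= c)%N) ->
  (count P s <= c * count Q s)%N.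
Proof.
move=> us PQ fib; rewrite -!sum1_count.
(* Double counting of the pairs [(h, k)] with [phi h = k]: each [h] in [P] lies in at least one,
   each [k] in at most [c]. *)
apply: (@leq_trans (\sum_(h <- s) \sum_(k <- s | Q k) (phi h == k))%N).
  rewrite big_mkcond !big_seq; apply: leq_sum => h hs; case: ifPn => // Ph.
  have /andP[phs Qph] := PQ _ hs Ph.
  rewrite big_mkcond (bigD1_seq (phi h))//= Qph eqxx.
  exact: leq_addr.
rewrite exchange_big/= big_distrr/=; apply: leq_sum => k _.
rewrite muln1 (leq_trans _ (fib k))// -sum1_count [leqRHS]big_mkcond/=.
by apply: leq_sum => h _; case: eqP.
Qed.

(** * Integrals of counting functions *)

Lemma integral_count {R : realType} {d} {X : measurableType d}
    (mu : probability X R) (s : seq (set X)) :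
  {in s, forall A, measurable A} ->
  measurable_fun [set: X] (fun x => (count (fun A => x \in A) s)%:R : R) /\
  (\int[mu]_x ((count (fun A => x \in A) s)%:R%:E) =
     (\sum_(A <- s) fine (mu A))%:E)%E.
Proof.
elim: s => [|A s ih] ms.
  by rewrite /= big_nil integral0; split => //; exact: measurable_cst.
have [|mf If] := ih; first by move=> B Bs; apply: ms; rewrite in_cons Bs orbT.
have mA : measurable A by apply: ms; rewrite mem_head.
have E x : (count (fun A => x \in A) (A :: s))%:R =
    \1_A x + (count (fun A => x \in A) s)%:R :> R by rewrite /= natrD indicE.
split; first by under eq_fun do rewrite E; exact: measurable_funD.
under eq_integral do rewrite E EFinD.
rewrite ge0_integralD//; last 2 first.
  exact/measurable_EFinP.
  exact/measurable_EFinP.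
by rewrite integral_indic// setIT If big_cons EFinD fineK// fin_num_measure.
Qed.

(** Integrating the pointwise inequality between multiplicities turns counting in the group into a
    bound on measures. *)
Lemma sum_measure_le_count {R : realType} {d} {X : measurableType d}
    (mu : probability X R) (s t : seq (set X)) :
  {in s, forall A, measurable A} -> {in t, forall A, measurable A} ->
  (forall x, (count (fun A => x \in A) s <= count (fun A => x \in A) t)%N) ->
  \sum_(A <- s) fine (mu A) <= \sum_(A <- t) fine (mu A).
Proof.
move=> /(integral_count mu)[ms Is] /(integral_count mu)[mt It] st.
rewrite -lee_fin -Is -It; apply: ge0_le_integral => //.
- by apply/measurable_EFinP.
- by apply/measurable_EFinP.
- by move=> x _; rewrite lee_fin ler_nat.
Qed.

(** * Atoms and zero-one measures *)

(* With [f] a Borel embedding in the line, the atom sits at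
   [f x = sup {r | mu (f <= r) = 0}]. *)
Lemma exists_atom {R : realType} {d} {X : measurableType d}
    (mu : probability X R) (e : R) :
  standard_borel R X -> 0 < e ->
  (forall A, measurable A -> mu A = 0%E \/ (e%:E <= mu A)%E) ->
  exists2 x, measurable [set x] & (e%:E <= mu [set x])%E.
Proof.
move=> [f [finj mf _ _]] e0 mu_e.
pose F r := [set x | f x <= r].
have mF r : measurable (F r).
  rewrite (_ : F r = f @^-1` `]-oo, r]); last by apply/seteqP; split => x; rewrite /= in_itv.
  by rewrite -[X in measurable X]setTI; apply: mf.
have F_le r r' : r <= r' -> F r `<=` F r' by move=> rr' x /= /le_trans; apply.
pose S := [set r | mu (F r) = 0%E].
have S_dn r r' : r' <= r -> S r -> S r'.
  move=> rr' Sr; apply/eqP; rewrite eq_le measure_ge0 andbT -[leRHS]Sr.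
  by rewrite le_measure ?inE//; exact: F_le.
(* [S] has a supremum: the sublevel sets exhaust [X], so not all are null; their intersection is
   empty, so not all have measure at least [e]. *)
have [r1 nSr1] : exists r, ~ S r.
  apply: contrapT => nS; have S1 n : mu (F n%:R) = 0%E.
    by apply: contrapT => Sn; apply: nS; exists n%:R.
  have : mu.-negligible (\bigcup_n F n%:R).
    by apply: negligible_bigcup => n; apply/negligibleP; [exact: mF|exact: S1].
  have -> : \bigcup_n F n%:R = [set: X].
    rewrite -subTset => x _; exists (Num.truncn `|f x|).+1 => //.
    rewrite /F /= (le_trans (ler_norm _))// ltW//.
    by rewrite truncnS_gt.
  move/negligibleP => /(_ measurableT) m0.
  by have := probability_setT mu; rewrite m0 => /eqP; rewrite eq_sym onee_eq0.
have [r0 Sr0] : exists r, S r.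
  apply: contrapT => nS.
  pose w n : R := - n%:R.
  have : (e%:E <= mu (\bigcap_n F (w n)))%E.
    have cv : (mu \o (fun n => F (w n))) n @[n --> \oo] --> mu (\bigcap_n F (w n)).
      apply: nonincreasing_cvg_mu => //.
      - by rewrite (le_lt_trans (probability_le1 _ _))// ltry.
      - exact: bigcapT_measurable.
      - by move=> n m nm; apply/subsetPset; apply: F_le; rewrite /w lerN2 ler_nat.
    rewrite -(cvg_lim _ cv)//; apply: lime_ge; first by apply/cvg_ex; eexists; exact: cv.
    apply: nearW => n; have [|//] := mu_e _ (mF (w n)).
    by move=> Sn; exfalso; apply: nS; exists (w n).
  have -> : \bigcap_n F (w n) = set0.
    rewrite -subset0 => x /(_ (Num.truncn `|f x|).+1 I) /=.
    rewrite /F/= /w lerNr leNgt => /negP; apply.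
    by rewrite (le_lt_trans (ler_norm _))// normrN truncnS_gt.
  by rewrite measure0 lee_fin leNgt e0.
have ubS : ubound S r1.
  by move=> r Sr; rewrite leNgt; apply/negP => /ltW rr1; exact/nSr1/(S_dn r).
have hsS : has_sup S by split; [exists r0|exists r1].
pose t := sup S.
have Slt r : r < t -> S r.
  move=> /(sup_gt (ex_intro _ _ Sr0))[r' Sr' rr']; exact: S_dn (ltW rr') Sr'.
have Sgt r : t < r -> (e%:E <= mu (F r))%E.
  move=> tr; have [Sr|//] := mu_e _ (mF r).
  by have := ub_le_sup hsS.2 Sr; rewrite leNgt tr.
(* [F t] is the decreasing limit of the [F (u n)], of measure at least [e]; the [F (v n)] are null
   and exhaust [f < t]. The difference is the fiber over [t]. *)
pose u n := t + n.+1%:R^-1; pose v n := t - n.+1%:R^-1.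
have A1 : (e%:E <= mu (F t))%E.
  have -> : F t = \bigcap_n F (u n).
    apply/seteqP; split => [x /= xt n _|x xu /=].
      by rewrite /F /= (le_trans xt)// lerDl.
    apply/ler_addgt0Pl => k k0.
    have := xu (Num.truncn k^-1) I; rewrite /F /= /u => /le_trans; apply.
    rewrite addrC lerD2r invf_ple ?posrE// ltW// truncnS_gt//.
  have cv : (mu \o (fun n => F (u n))) n @[n --> \oo] --> mu (\bigcap_n F (u n)).
    apply: nonincreasing_cvg_mu => //.
    - by rewrite (le_lt_trans (probability_le1 _ _))// ltry.
    - exact: bigcapT_measurable.
    - move=> n m nm; apply/subsetPset; apply: F_le; rewrite lerD2l.
      by rewrite lef_pV2 ?posrE// ler_nat.
  rewrite -(cvg_lim _ cv)//; apply: lime_ge; first by apply/cvg_ex; eexists; exact: cv.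
  by apply: nearW => n; apply: Sgt; rewrite /u ltrDl.
have mL : measurable (\bigcup_n F (v n)) by exact: bigcupT_measurable.
have A2 : mu (\bigcup_n F (v n)) = 0%E.
  suff: mu.-negligible (\bigcup_n F (v n)) by move/negligibleP => /(_ mL).
  apply: negligible_bigcup => n.
  by apply/negligibleP; [exact: mF|apply: Slt; rewrite /v ltrBlDr ltrDl].
have Et : f @^-1` [set t] = F t `\` \bigcup_n F (v n).
  apply/seteqP; split => x /=.
    move=> fxt; split; first by rewrite /F /= fxt.
    by move=> [n _]; rewrite /F /= fxt /v leNgt ltrBlDr ltrDl invr_gt0 ltr0n.
  move=> [xt nx]; apply/eqP; rewrite eq_le; apply/andP; split => //.
  rewrite leNgt; apply/negP => ltx; apply: nx.
  exists (Num.truncn (t - f x)^-1) => //=.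
  rewrite /F /= /v lerBrDr -lerBrDl invf_ple ?posrE ?subr_gt0//.
  by rewrite ltW// truncnS_gt.
have mt : (e%:E <= mu (f @^-1` [set t]))%E.
  have m1 : measurable (f @^-1` [set t]) by rewrite Et; exact: measurableD.
  apply: (le_trans A1); rewrite -[leRHS]adde0 -A2.
  apply: (le_trans _ (measureU2 _ m1 mL)); rewrite le_measure ?inE//.
    exact: measurableU.
  by rewrite Et setUC => x Fx; have [|] := pselect ((\bigcup_n F (v n)) x); [left|right].
have [x ftx] : exists x, f x = t.
  apply: contrapT => nx; move: mt; rewrite (_ : _ @^-1` _ = set0).
    by rewrite measure0 lee_fin leNgt e0.
  by rewrite -subset0 => x fxt; apply: nx; exists x.
have Ex : f @^-1` [set t] = [set x].
  by apply/seteqP; split => y /=; [rewrite -ftx => /finj|move=> ->].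
exists x; last by rewrite -Ex.
by rewrite -Ex Et; exact: measurableD.
Qed.

Lemma ae_forall_count {R : realType} {d} {X : measurableType d}
    (mu : probability X R) (I : countType) (P : I -> X -> Prop) :
  (forall i, {ae mu, forall x, P i x}) -> {ae mu, forall x, forall i, P i x}.
Proof.
move=> aeP.
pose Q n x := if unpickle n is Some i then P i x else True.
have : {ae mu, forall x, forall n, Q n x}.
  apply: ae_foralln => n; rewrite /Q; case: (unpickle n) => [i|]; first exact: aeP.
  exact: aeW.
by apply: filterS => x Qx i; have := Qx (pickle i); rewrite /Q pickleK.
Qed.

Lemma measurable_forall {d} {X : measurableType d} (I : countType)
    (F : I -> set X) :
  (forall i, measurable (F i)) -> measurable [set x | forall i, F i x].
Proof.
move=> mF; rewrite (_ : [set _ | _] = ~` \bigcup_i (~` F i)); last first.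
  by rewrite setC_bigcup; apply/seteqP; split => x /= Fx i => [_|]; rewrite ?setCK;
    [exact: Fx|have := Fx i Logic.I; rewrite setCK].
apply: measurableC; apply: countable_bigcupT_measurable => // i.
exact: measurableC.
Qed.

Lemma point_mass {R : realType} {d} {X : measurableType d}
    (mu : probability X R) (x : X) :
  measurable [set x] -> mu [set x] = 1%E -> ~ nontrivial_measure mu.
Proof.
move=> mx mux; apply; exists x.
have full (A : set X) : measurable A -> A x -> mu A = 1%E.
  move=> mA Ax; apply/eqP; rewrite eq_le probability_le1//= -mux.
  by rewrite le_measure ?inE// => _ ->.
move=> A mA; rewrite diracE; case: (boolP (x \in A)) => [/set_mem Ax|/negP xA].
  exact: full.
rewrite -[A]setCK probability_setC; last exact: measurableC.
rewrite full ?subee//; first exact: measurableC.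
by move=> Ax; apply: xA; rewrite inE.
Qed.

(** The threshold [e = 1] is admissible in [exists_atom], and the resulting atom carries all the
    mass. *)
Lemma zero_one_trivial {R : realType} {d} {X : measurableType d}
    (mu : probability X R) :
  standard_borel R X ->
  (forall A, measurable A -> mu A = 0%E \/ mu A = 1%E) ->
  ~ nontrivial_measure mu.
Proof.
move=> sb mu01; have [|x mx x1] := @exists_atom _ _ _ mu 1 sb ltr01.
  by move=> A mA; have [->|->] := mu01 A mA; [left|right].
have mx1 : mu [set x] = 1%E by apply/eqP; rewrite eq_le x1 probability_le1.
exact: point_mass mx mx1.
Qed.

(** * The action and its fixed-point sets *)

Section action.
Context {G : countType} {mul : G -> G -> G} {one : G} {inv : G -> G}.
Context {R : realType} {d : measure_display} {X : measurableType d}.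
Context {mu : probability X R} {a : G -> X -> X}.
Hypothesis grp : is_group mul one inv.
Hypothesis sb : standard_borel R X.
Hypothesis act : is_mp_action mul one mu a.

Let mulA x y z : mul x (mul y z) = mul (mul x y) z. Proof. by case: grp. Qed.
Let mul1 x : mul one x = x. Proof. by case: grp. Qed.
Let mulr1 x : mul x one = x. Proof. by case: grp. Qed.
Let mulV x : mul (inv x) x = one. Proof. by case: grp. Qed.
Let mulrV x : mul x (inv x) = one. Proof. by case: grp. Qed.
Let act1 x : a one x = x. Proof. by case: act. Qed.
Let actM g h x : a (mul g h) x = a g (a h x). Proof. by case: act. Qed.
Let actK g x : a (inv g) (a g x) = x. Proof. by rewrite -actM mulV act1. Qed.
Let actVK g x : a g (a (inv g) x) = x. Proof. by rewrite -actM mulrV act1. Qed.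

Lemma measurable_preact g (A : set X) : measurable A -> measurable (a g @^-1` A).
Proof.
by case: act => _ _ ma _ mA; rewrite -[X in measurable X]setTI; exact: ma.
Qed.

Lemma measure_preact g (A : set X) : measurable A -> mu (a g @^-1` A) = mu A.
Proof. by case: act => _ _ _; exact. Qed.

Definition fixed g : set X := [set x | a g x = x].
Definition fixed_all (H : set G) : set X := [set x | forall h, H h -> a h x = x].

(** The injection [f] turns [a g x = x] into an equality of two measurable real functions. *)
Lemma measurable_fixed g : measurable (fixed g).
Proof.
case: sb => f [finj mf _ _].
rewrite (_ : fixed g = [set: X] `&` (fun x => f (a g x) == f x) @^-1` [set true]).
  apply: measurable_fun_eqr => //.
  by apply: measurableT_comp => //; case: act.
by rewrite setTI; apply/seteqP; split => x /=; [move=> ->; rewrite eqxx|move/eqP/finj].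
Qed.

Lemma measurable_fixed_all H : measurable (fixed_all H).
Proof.
rewrite (_ : fixed_all H =
    [set x | forall h, (if `[< H h >] then fixed h else [set: X]) x]).
  apply: measurable_forall => h; case: asboolP => _; last exact: measurableT.
  exact: measurable_fixed.
apply/seteqP; split => x /= fx h; first by case: asboolP => // /fx.
by move=> Hh; have := fx h; case: asboolP.
Qed.

(** * Consequences of total ergodicity *)

Hypothesis nontriv : nontrivial_measure mu.
Hypothesis terg : totally_ergodic mul one inv mu a.

(** This set is [H]-invariant, hence null or conull. If conull, every [A] differs by a null set from
    the invariant set [A] cut down to [fixed_all H], so [mu] takes only the values 0 and 1. *)
Lemma fixed_all_null H : is_subgroup mul one inv H -> infinite_set H ->
  mu (fixed_all H) = 0%E.
Proof.
move=> sH iH; have mH := measurable_fixed_all H.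
have inv_fix h x : H h -> fixed_all H (a h x) <-> fixed_all H x.
  move=> Hh; split => fx k Hk; last by rewrite !fx.
  suff E : a h x = x by have := fx k Hk; rewrite E.
  have [_ _ HV] := sH.
  by have := fx (inv h) (HV _ Hh); rewrite actK.
have [|//|H1] := terg _ sH iH _ mH.
  by move=> h Hh; apply/seteqP; split => x /=; move/(inv_fix h x Hh).
exfalso; apply: (zero_one_trivial mu sb _ nontriv) => A mA.
have fA : mu (A `&` fixed_all H) = mu A.
  apply/eqP; rewrite eq_le le_measure ?inE//=; last exact: measurableI.
  have H0 : mu (~` fixed_all H) = 0%E by rewrite probability_setC// H1 subee.
  rewrite -[leRHS]adde0 -H0.
  apply: (le_trans _ (measureU2 _ _ _)); rewrite ?le_measure ?inE//.
  - by apply: measurableU; [exact: measurableI|exact: measurableC].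
  - by move=> x Ax; have [] := pselect (fixed_all H x); [left|right].
  - exact: measurableI.
  - exact: measurableC.
rewrite -fA; apply: (terg _ sH iH); first exact: measurableI.
move=> h Hh; apply/seteqP; split => x /= [Ax].
  by move/(inv_fix h x Hh) => fx; move: Ax; rewrite (fx h).
by move=> fx; split; [rewrite (fx h)|apply/inv_fix].
Qed.

(** If the setwise stabilizer [P] of [A] in [H] is infinite, ergodicity of [P] applies. If it is
    finite, the infinitely many preimages of [A] have equal measure and cover each point at most
    [#|P|] times, forcing [A] to be null. *)
Lemma block_full H A : is_subgroup mul one inv H -> infinite_set H ->
  measurable A -> mu A <> 0%E ->
  (forall h, H h -> a h @^-1` A = A \/ (forall x, A x -> ~ A (a h x))) ->
  mu A = 1%E.
Proof.
move=> sH iH mA A0 AH.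
have [H1 HM HV] := sH.
pose P := [set h | H h /\ a h @^-1` A = A].
have sP : is_subgroup mul one inv P.
  split; first by split => //; apply/seteqP; split => x /=; rewrite act1.
    move=> g h [Hg Eg] [Hh Eh]; split; first exact: HM.
    have -> : a (mul g h) @^-1` A = a h @^-1` (a g @^-1` A).
      by apply/seteqP; split => x /=; rewrite actM.
    by rewrite Eg.
  move=> g [Hg Eg]; split; first exact: HV.
  by rewrite -[in LHS]Eg; apply/seteqP; split => x /=; rewrite actVK.
have [iP|fP] := pselect (infinite_set P).
  by have [h []|/A0|] := terg _ sP iP _ mA.
exfalso; apply: A0.
have {fP} /finite_seqP[t Et] : finite_set P by exact: contrapT.
have m0 : 0 <= fine (mu A) by rewrite fine_ge0.
have bound (s : seq G) : uniq s -> {in s, forall g, H g} ->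
    (size s)%:R * fine (mu A) <= (size t)%:R.
  move=> us sHs.
  have := @sum_measure_le_count _ _ _ mu [seq a g @^-1` A | g <- s]
     (nseq (size t) [set: X]).
  rewrite big_map big_nseq.
  under eq_bigr do rewrite measure_preact//.
  rewrite big_const_seq count_predT !iter_addr_0 probability_setT /= mulr_natl; apply.
  - by move=> _ /mapP[g _ ->]; exact: measurable_preact.
  - by move=> _ /nseqP[->].
  move=> x; rewrite count_map count_nseq /= in_setT mul1n.
  rewrite (@eq_in_count _ _ (fun g => (x \in a g @^-1` A) && (g \in s))); last first.
    by move=> g gs /=; rewrite gs andbT.
  (* If [g x] and [h x] lie in [A], then [g h^-1] sends a point of [A] into [A], so by the dichotomy
     it lies in [P]. *)
  apply: (count_le_translates _ _ _ _ _ _ _ grp us) => g h /andP[/set_mem Ag gs].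
  move=> /andP[/set_mem Ah hs]; suff : P (mul g (inv h)) by rewrite Et.
  have Hgh : H (mul g (inv h)) by apply: HM; [exact: sHs|apply/HV/sHs].
  split => //; have [//|/(_ _ Ah)] := AH _ Hgh.
  by rewrite actM actK.
apply/eqP; rewrite -[_ == _]negbK; apply/negP => muA0.
have m_gt0 : 0 < fine (mu A).
  by rewrite lt_neqAle m0 eq_sym fine_eq0// ?fin_num_measure// muA0.
have [F sF szF] := infinite_set_fset (Num.truncn ((size t)%:R / fine (mu A))).+1 iH.
have := bound F (fset_uniq F) (fun g gF => sF g gF).
rewrite leNgt -ltr_pdivrMr// => /negP; apply.
by rewrite (lt_le_trans (truncnS_gt _))// ler_nat.
Qed.

(** * Generated subgroups and stabilizers *)

Definition generated (s : seq G) : set G :=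
  [set g | forall K, is_subgroup mul one inv K -> {in s, forall k, K k} -> K g].

Lemma generated_subgroup s : is_subgroup mul one inv (generated s).
Proof.
split => [K [] //|x y sx sy K sK Ks|x sx K sK Ks]; have [_ KM KV] := sK.
  by apply: KM; [exact: sx|exact: sy].
by apply: KV; exact: sx.
Qed.

Lemma stabilizer_subgroup x : is_subgroup mul one inv (stabilizer a x).
Proof.
split => [|g h /= gx hx|g /= gx]; first exact: act1.
  by rewrite /stabilizer /= actM hx.
by rewrite /stabilizer /= -[in LHS]gx actK.
Qed.

Lemma stabilizer_act h x g :
  stabilizer a (a h x) g <-> stabilizer a x (mul (mul (inv h) g) h).
Proof.
rewrite /stabilizer /= !actM; split => [->|/(congr1 (a h))]; first by rewrite actK.
by rewrite actVK.
Qed.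

Lemma null_ae (A : set X) : measurable A -> mu A = 0%E -> {ae mu, forall x, ~ A x}.
Proof.
by move=> mA A0; exists A; split => // x /= /contrapT.
Qed.

Lemma ae_False : ~ {ae mu, forall x : X, False}.
Proof.
move=> [A [mA A0 sA]]; have := probability_setT mu.
rewrite (_ : [set: X] = A) ?A0; first by move=> /eqP; rewrite eq_sym onee_eq0.
by apply/esym; rewrite -subTset => x _; apply: sA => /=.
Qed.

(** * A lower bound for positive measures *)

(* For a finite subgroup [F] of [H] containing [gam], the map
   [h |-> h^-1 gam h] sends [{h in F | gam h x = h x}] into the stabilizer of [x]
   in [F], with fibers of size at most [size t]; if [g0 x] lies in [A], left
   multiplication by [g0] sends that stabilizer into [{g in F | g x in A}].
   Integrate over [x] and let [F] exhaust [H]. *)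
Lemma measure_ge_fixed H (gam : G) (t : seq G) (A : set X) :
  is_subgroup mul one inv H -> infinite_set H ->
  (forall s : seq G, {in s, forall g, H g} -> finite_set (generated s)) ->
  H gam -> [set g | mul g gam = mul gam g] = [set` t] ->
  measurable A -> mu A <> 0%E ->
  fine (mu (fixed gam)) / (size t)%:R <= fine (mu A).
Proof.
move=> sH iH lfH Hgam Et mA A0.
have [H1 HM HV] := sH.
have t0 : (0 < size t)%N.
  have : one \in t by have : [set` t] one by rewrite -Et /= mul1 mulr1.
  by case: t {Et}.
rewrite ler_pdivrMr ?ltr0n//; apply/ler_addgt0Pr => e e0.
(* An enumeration of the preimages of [A] under [H], with [set0] for codes outside [H]; the union is
   [H]-invariant and contains [A], hence conull. *)
pose E i := if unpickle i is Some g then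
  if `[< H g >] then a g @^-1` A else set0 else set0.
have mE i : measurable (E i).
  by rewrite /E; case: (unpickle i) => // g; case: asboolP => // _; exact: measurable_preact.
have EP x : (\bigcup_i E i) x <-> exists2 g, H g & A (a g x).
  split => [[i _]|[g Hg Ag]]; last by exists (pickle g) => //; rewrite /E pickleK asboolT.
  by rewrite /E; case: (unpickle i) => // g; case: asboolP => // Hg Ag; exists g.
have mEU : measurable (\bigcup_i E i) by exact: bigcupT_measurable.
have EU1 : mu (\bigcup_i E i) = 1%E.
  have [h Hh|EU0|//] := terg _ sH iH _ mEU.
    apply/seteqP; split => x /= /EP[g Hg Ag]; apply/EP.
      by exists (mul g h); [exact: HM|rewrite actM].
    by exists (mul g (inv h)); [by apply: HM => //; exact: HV|rewrite actM actK].
  exfalso; apply: A0; apply/eqP; rewrite eq_le measure_ge0 andbT -[leRHS]EU0.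
  by rewrite le_measure ?inE// => x Ax; apply/EP; exists one; rewrite ?act1.
pose W n := \bigcup_(i in `I_n) E i.
have mW n : measurable (W n) by exact: bigcup_measurable.
have [n Wn] : exists n, fine (mu (~` W n)) < e.
  have EW : \bigcap_n (~` W n) = ~` \bigcup_i E i.
    rewrite -setC_bigcup; congr (~` _); apply/seteqP; split => x [i _].
      by move=> [j _ Ej]; exists j.
    by move=> Ei; exists i.+1 => //; exists i => /=.
  have mCW n : measurable (~` W n) by exact: measurableC.
  have : (mu \o (fun n => ~` W n)) n @[n --> \oo] --> 0%:E.
    rewrite -[0%:E](subee (x := 1%E))// -[in X in (_ - X)%E]EU1 -probability_setC// -EW.
    apply: nonincreasing_cvg_mu => //.
    - by rewrite (le_lt_trans (probability_le1 _ _))// ltry.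
    - exact: bigcapT_measurable.
    move=> n m nm; apply/subsetPset; apply: subsetC => x [i /= ni Ei].
    by exists i => //=; exact: leq_trans nm.
  by move=> /fine_cvg /cvgr_lt /(_ e e0)[k _ /(_ k (leqnn k))] /= ke; exists k.
(* Generators chosen so that the finite subgroup [F] contains [gam] and moves every point of [W n]
   into [A]. *)
pose s := gam :: [seq g <- pmap unpickle (iota 0 n) | `[< H g >]].
have sH' : {in s, forall g, H g}.
  move=> g; rewrite in_cons => /predU1P[->//|].
  by rewrite mem_filter => /andP[/asboolP].
have /finite_seqP[u Eu] := lfH _ sH'.
pose F := undup u.
have EF : generated s = [set` F] by rewrite Eu; apply/seteqP; split => g /=; rewrite mem_undup.
have FP g : g \in F <-> generated s g by rewrite EF.
have [F1 FM FV] := generated_subgroup s.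
have gamF : gam \in F by apply/FP => K _; apply; rewrite mem_head.
have WF x : W n x -> exists2 g, g \in F & A (a g x).
  move=> [i /= ilt]; rewrite /E; case Ei : (unpickle i) => [g|//].
  case: asboolP => // Hg Ag; exists g => //; apply/FP => K _; apply.
  rewrite in_cons mem_filter asboolT//= mem_pmap; apply/orP; right.
  by apply/mapP; exists i; rewrite // mem_iota.
have uF : uniq F by exact: undup_uniq.
have F0 : (0 < size F)%N by rewrite -has_predT; apply/hasP; exists gam.
have Es B : measurable B ->
    \sum_(g <- F) fine (mu (a g @^-1` B)) = fine (mu B) *+ size F.
  move=> mB; rewrite (eq_bigr (fun=> fine (mu B))); last first.
    by move=> g _; rewrite measure_preact.
  by rewrite big_const_seq count_predT iter_addr_0.
(* The [size F] copies of the complement of [W n] absorb the points for which no [g0] is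
   available. *)
have := @sum_measure_le_count _ _ _ mu [seq a h @^-1` fixed gam | h <- F]
  (flatten (nseq (size t) [seq a g @^-1` A | g <- F]) ++ nseq (size F) (~` W n)).
rewrite big_map big_cat big_flatten /= !big_nseq big_map !iter_addr_0.
rewrite !Es//; last exact: measurable_fixed.
move=> main.
have {main} : fine (mu (fixed gam)) *+ size F <=
    fine (mu A) *+ size F *+ size t + fine (mu (~` W n)) *+ size F.
  apply: main.
  - by move=> _ /mapP[h _ ->]; apply: measurable_preact; exact: measurable_fixed.
  - move=> B; rewrite mem_cat => /orP[/flattenP[_ /nseqP[-> _] /mapP[h _ ->]]|].
      exact: measurable_preact.
    by move=> /nseqP[-> _]; exact: measurableC.
  move=> x; rewrite count_cat count_flatten map_nseq sumn_nseq count_nseq !count_map.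
  have [Wx|nWx] := pselect (W n x); last first.
    rewrite (@mem_set _ (~` W n) x) // mul1n.
    by apply: leq_trans (leq_addl _ _); exact: count_size.
  have [g0 g0F Ag0] := WF x Wx.
  apply: leq_trans (leq_addr _ _).
  rewrite mulnC.
  apply: (@count_le_fibers _ _ _ _ (fun h => mul g0 (mul (inv h) (mul gam h)))) => //.
  - move=> h /FP hF /= /set_mem; rewrite /fixed /= => gh; apply/andP; split.
      apply/FP; apply: (FM _ _ ((FP _).1 g0F)).
      by apply: (FM _ _ (FV _ hF)); apply: (FM _ _ ((FP _).1 gamF)).
    by rewrite inE /= !actM gh actK.
  (* If [g] and [h] conjugate [gam] to the same element, [g h^-1] centralizes [gam]; this bounds the
     fibers by [size t]. *)
  move=> k; apply: (count_le_translates _ _ _ _ _ _ _ grp uF) => g h /eqP <- /eqP.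
  move=> /(congr1 (mul (inv g0))); rewrite !mulA !mulV !mul1 -!mulA => gh.
  suff : [set g | mul g gam = mul gam g] (mul g (inv h)) by rewrite Et.
  rewrite /= -mulA; move: gh => /(congr1 (mul g)).
  rewrite !mulA mulrV mul1 => /(congr1 (mul^~ (inv h))).
  by rewrite /= -!mulA mulrV mulr1.
rewrite mulrnAC -mulrnDl lerMn2r eqn0Ngt F0 /= => /le_trans; apply.
by rewrite mulr_natr lerD2l ltW.
Qed.

(** * Finiteness of almost every stabilizer *)

Lemma ae_finite_stabilizer : {ae mu, forall x, finite_set (stabilizer a x)}.
Proof.
have gen1 : {ae mu, forall x, forall s : seq G,
    infinite_set (generated s) -> ~ fixed_all (generated s) x}.
  apply: ae_forall_count => s; have [iS|fS] := pselect (infinite_set (generated s)).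
    apply: filterS (null_ae _ (measurable_fixed_all _)
      (fixed_all_null _ (generated_subgroup s) iS)) => x nfx _.
    exact: nfx.
  by apply: aeW => x /fS.
have gen2 : {ae mu, forall x, forall g, mu (fixed g) = 0%E -> ~ fixed g x}.
  apply: ae_forall_count => g; have [g0|g0] := pselect (mu (fixed g) = 0%E).
    by apply: filterS (null_ae _ (measurable_fixed g) g0) => x nfx _.
  by apply: aeW => x /g0.
apply: filterS2 gen1 gen2 => x gen1 gen2; apply: contrapT => iH.
set H := stabilizer a x in iH.
have sH : is_subgroup mul one inv H by exact: stabilizer_subgroup.
(* A subgroup generated inside [H] fixes [x], so by the choice of [x] it cannot be infinite. *)
have lfH (s : seq G) : {in s, forall g, H g} -> finite_set (generated s).
  by move=> sH'; apply: contrapT => /gen1; apply => g sg; exact: (sg H sH sH').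
(* Otherwise almost every point would be fixed by all of [H], against [fixed_all_null]. *)
have [gam Hgam gam1] : exists2 g, H g & mu (fixed g) <> 1%E.
  apply: contrapT => nH; apply: ae_False.
  have ae1 : {ae mu, forall y, forall g, H g -> fixed g y}.
    apply: ae_forall_count => g; have [Hg|nHg] := pselect (H g); last first.
      by apply: aeW => y /nHg.
    have g1 : mu (fixed g) = 1%E by apply: contrapT => g1; apply: nH; exists g.
    have mg := measurable_fixed g.
    have : mu (~` fixed g) = 0%E by rewrite probability_setC// g1 subee.
    by move=> /(null_ae _ (measurableC mg)); apply: filterS => y /= /contrapT.
  apply: filterS2 ae1 (null_ae _ (measurable_fixed_all H) (fixed_all_null _ sH iH)).
  by move=> y fy; apply.
have gam0 : mu (fixed gam) <> 0%E by move=> /gen2; apply.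
pose C := [set g | mul g gam = mul gam g].
have sC : is_subgroup mul one inv C.
  split => [|g h|g]; rewrite /C /= ?mul1 ?mulr1//.
    by move=> gg hg; rewrite -mulA hg mulA gg mulA.
  move=> gg; rewrite -[LHS]mulr1 -(mulrV g) -mulA [mul gam _]mulA -gg.
  by rewrite !mulA mulV mul1.
have /finite_seqP[t Et] : finite_set C.
  apply: contrapT => iC.
  have [g Cg|//|//] := terg _ sC iC _ (measurable_fixed gam).
  apply/seteqP; split => y /=; rewrite /fixed /= -actM -Cg actM.
    by move=> /(congr1 (a (inv g))); rewrite !actK.
  by move=> ->.
have bound A := @measure_ge_fixed H gam t A sH iH lfH Hgam Et.
have t0 : (0 < size t)%N.
  have : one \in t by have : [set` t] one by rewrite -Et /C /= mul1 mulr1.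
  by case: (t).
have c0 : 0 < fine (mu (fixed gam)) / (size t)%:R.
  rewrite divr_gt0 ?ltr0n// lt_neqAle fine_ge0// andbT eq_sym.
  by rewrite fine_eq0 ?fin_num_measure//; [exact/eqP|exact: measurable_fixed].
have [|y my y_gt0] := @exists_atom _ _ _ mu _ sb c0.
  move=> A mA; have [|A0] := pselect (mu A = 0%E); [by left|right].
  by rewrite -[mu A]fineK ?fin_num_measure// lee_fin bound.
(* A singleton and its translates are equal or disjoint, so [block_full] gives the atom full
   measure. *)
apply: (point_mass _ _ my) nontriv; apply: (block_full _ _ sH iH my).
  by move=> y0; move: y_gt0; rewrite y0 lee_fin leNgt c0.
move=> h Hh; have [hy|hy] := pselect (a h y = y).
  left; apply/seteqP; split => z /=; last by move=> ->.
  by move=> hz; rewrite -[LHS](actK h) hz -[in LHS]hy actK.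
by right => z /= ->.
Qed.

(** * Constancy and normality of the stabilizer *)

Lemma stabilizer_ae_constant : infinite_set [set: G] ->
  exists N : set G,
    [/\ is_subgroup mul one inv N, finite_set N, is_normal mul inv N &
        {ae mu, forall x, stabilizer a x = N}].
Proof.
move=> iG.
(* Finite subsets are coded by lists, of which there are countably many, so some [E s] is not
   null. *)
pose E (s : seq G) := [set x | stabilizer a x = [set` s]].
have mE s : measurable (E s).
  rewrite (_ : E s = [set x | forall g,
      (if g \in s then fixed g else ~` fixed g) x]).
    apply: measurable_forall => g; case: ifP => _; first exact: measurable_fixed.
    by apply: measurableC; exact: measurable_fixed.
  apply/seteqP; split => x /= Ex.
    move=> g; have Exg : stabilizer a x g = (g \in s) by rewrite Ex.
    by case: ifPn => [gs|/negP gs]; [rewrite -Exg in gs|rewrite -Exg in gs].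
  apply/seteqP; split => g /=; have := Ex g; case: ifP => //.
have [s s0] : exists s, mu (E s) <> 0%E.
  apply: contrapT => nE; apply: ae_False.
  have : {ae mu, forall x, forall s, ~ E s x}.
    apply: ae_forall_count => s; apply: null_ae => //.
    by apply: contrapT => s0; apply: nE; exists s.
  apply: filterS2 ae_finite_stabilizer => x /finite_seqP[s xs] /(_ s); exact.
set N : set G := [set` s].
have conj h x : E s x -> E s (a h x) -> forall g, N g <-> N (mul (mul (inv h) g) h).
  by move=> Ex Ehx g; rewrite -[X in X g]Ehx -[X in X (mul _ _)]Ex stabilizer_act.
have sG : is_subgroup mul one inv [set: G] by [].
have E1 : mu (E s) = 1%E.
  (* A single [x] with both [x] and [h x] in [E s] makes [h] normalize [N], and then [h] preserves
     all of [E s]. *)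
  apply: (block_full _ _ sG iG (mE s) s0) => h _.
  have [[x Ex Ehx]|nx] := pselect (exists2 x, E s x & E s (a h x)); last first.
    by right => x Ex Ehx; apply: nx; exists x.
  left; have NE := conj h x Ex Ehx.
  apply/seteqP; split => y /= Ey; apply/seteqP; split => g.
  - move=> yg.
    have : stabilizer a (a h y) (mul (mul h g) (inv h)).
      by apply/stabilizer_act; rewrite !mulA mulV mul1 -mulA mulV mulr1.
    rewrite Ey => /NE; by rewrite !mulA mulV mul1 -mulA mulV mulr1.
  - move=> Ng; have : N (mul (mul h g) (inv h)).
      by apply/NE; rewrite !mulA mulV mul1 -mulA mulV mulr1.
    by rewrite /N -Ey => /stabilizer_act; rewrite !mulA mulV mul1 -mulA mulV mulr1.
  - by move=> /stabilizer_act; rewrite Ey => /(NE g).2.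
  - by move=> /(NE g).1 Ng; apply/stabilizer_act; rewrite Ey.
have aeE : {ae mu, forall x, E s x}.
  have : mu (~` E s) = 0%E by rewrite probability_setC// E1 subee.
  by move=> /(null_ae _ (measurableC (mE s))); apply: filterS => y /= /contrapT.
exists N; split; last by apply: filterS aeE.
- have [x Ex] : exists x, E s x.
    by apply: contrapT => nx; apply: ae_False; apply: filterS aeE => x Ex; apply: nx; exists x.
  by rewrite /N -Ex; exact: stabilizer_subgroup.
- by apply/finite_seqP; exists s.
(* [E s] and its preimage under [g] are both conull, so they meet; a common point shows that [g]
   normalizes [N]. *)
move=> g n Nn; have [x Ex Egx] : exists2 x, E s x & E s (a g x).
  apply: contrapT => nx; apply: ae_False.
  have aegE : {ae mu, forall x, E s (a g x)}.
    have : mu (a g @^-1` (~` E s)) = 0%E.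
      by rewrite measure_preact ?probability_setC ?E1 ?subee//; exact: measurableC.
    move=> /(null_ae _ (measurable_preact g _ (measurableC (mE s)))).
    by apply: filterS => y /= /contrapT.
  by apply: filterS2 aeE aegE => x Ex Egx; apply: nx; exists x.
by apply/(conj g x Ex Egx); rewrite !mulA mulV mul1 -mulA mulV mulr1.
Qed.

End action.

Theorem theorem1p4 (G : Type) (mul : G -> G -> G) (one : G) (inv : G -> G)
  (R : realType) (d : measure_display) (X : measurableType d)
  (mu : probability X R) (a : G -> X -> X) :
  is_group mul one inv -> countably_infinite G ->
  standard_borel R X ->
  is_mp_action mul one mu a ->
  nontrivial_measure mu ->
  totally_ergodic mul one inv mu a ->
  exists N : set G,
    [/\ is_subgroup mul one inv N, finite_set N, is_normal mul inv N &
        {ae mu, forall x, stabilizer a x = N}].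
Proof.
move=> grp [f [g fK gK]] sb act nontriv terg.
(* The bijection with [nat] supplies the countable type structure on [G]. *)
apply: (@stabilizer_ae_constant (can_type gK) mul one inv _ _ _ mu a) => //.
move=> fG; apply: infinite_nat.
rewrite (_ : [set: nat] = g @` [set: G]); first exact: finite_image.
by apply/seteqP; split => // n _; exists (f n).
Qed.
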